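(* Let $A\in\mathbb R^{d,d}$ be invertible and let $\mathbb R^d=X_s\oplus X_u$ be a decomposition into (nontrivial) invariant subspaces of $A$ such that the restrictions $A_s=A_{|X_s}$ and $A_u=A_{|X_u}$ satisfy $|\sigma(A_s)|<|\sigma(A_u)|$, i.e. $|\lambda|<|\mu|$ for all $\lambda\in\sigma(A_s)$, $\mu\in\sigma(A_u)$. Then for each of the four types of angular values $\theta_1\in\{\bar\theta_1,\underline\theta_1,\hat\theta_1,\check\theta_1\}$, $$\theta_1(A)=\max(\theta_1(A_s),\theta_1(A_u)).$$
   Context: For nonzero $v,w\in\mathbb R^d$, $\measuredangle(v,w)=\arccos\frac{|v^\top w|}{\|v\|\|w\|}\in[0,\frac\pi2]$ with the Euclidean inner product and norm. For an invertible linear map $B:X\to X$ of a nonzero subspace $X\subseteq\mathbb R^d$ (with the Euclidean inner product inherited from $\mathbb R^d$; $X=\mathbb R^d$ for $B=A$) put $a_{1,n}(v)=\sum_{j=1}^n\measuredangle(B^{j-1}v,B^jv)$ for $v\in X\setminus\{0\}$, $n\in\mathbb N$. The first angular values of $B$ are, with suprema over $v\in X\setminus\{0\}$: upper/lower inner $\bar\theta_1(B)=\limsup_{n\to\infty}\frac1n\sup_va_{1,n}(v)$, $\underline\theta_1(B)=\liminf_{n\to\infty}\frac1n\sup_va_{1,n}(v)$; upper/lower outer $\hat\theta_1(B)=\sup_v\limsup_{n\to\infty}\frac1na_{1,n}(v)$, $\check\theta_1(B)=\sup_v\liminf_{n\to\infty}\frac1na_{1,n}(v)$. *)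

(* Defs.v *)
From HB Require Import structures.
From mathcomp Require Import all_boot all_order all_algebra.
From mathcomp Require Import complex.
From mathcomp Require Import all_classical all_reals all_analysis.

Set Implicit Arguments.
Unset Strict Implicit.
Unset Printing Implicit Defensive.

Import Order.TTheory GRing.Theory Num.Theory.
Local Open Scope classical_set_scope.
Local Open Scope ring_scope.

Definition dotp (R : realType) (d : nat) (v w : 'cV[R]_d) : R :=
  (v^T *m w) ord0 ord0.

(* Not the norm `|v| of the library, which is the sup norm on matrices. *)
Definition enorm (R : realType) (d : nat) (v : 'cV[R]_d) : R :=
  Num.sqrt (dotp v v).

Definition angle (R : realType) (d : nat) (v w : 'cV[R]_d) : R :=
  acos (`|dotp v w| / (enorm v * enorm w)).

(* A linear map B : X -> X of a subspace X of R^d is an element of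
   'End(subvs_of X). The map restr A X is v |-> A v followed by a projection
   onto X, which has no effect if X is invariant (restrE); X = fullv gives A
   itself. *)
Definition restr (R : realType) (d : nat) (A : 'M[R]_d)
    (X : {vspace 'cV[R]_d}) : 'End(subvs_of X) :=
  linfun (fun v : subvs_of X => vsproj X (A *m vsval v)).

Definition invariant_subspace (R : realType) (d : nat) (A : 'M[R]_d)
    (X : {vspace 'cV[R]_d}) : Prop :=
  forall v : 'cV[R]_d, v \in X -> A *m v \in X.

Lemma restrE (R : realType) (d : nat) (A : 'M[R]_d) (X : {vspace 'cV[R]_d})
    (v : subvs_of X) :
  invariant_subspace A X -> vsval (restr A X v) = A *m vsval v.
Proof.
move=> AX.
have lin : linear (fun v : subvs_of X => vsproj X (A *m vsval v)).
  by move=> a x y; rewrite !linearP.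
pose f := HB.pack_for {linear subvs_of X -> subvs_of X}
  (fun v : subvs_of X => vsproj X (A *m vsval v))
  (GRing.isLinear.Build _ _ _ _ _ lin).
by rewrite (lfunE f) /= vsprojK // AX // subvsP.
Qed.

Lemma restr_fullE (R : realType) (d : nat) (A : 'M[R]_d)
    (v : subvs_of (fullv : {vspace 'cV[R]_d})) :
  vsval (restr A fullv v) = A *m vsval v.
Proof. by apply: restrE => w _; rewrite memvf. Qed.

(* The complex eigenvalues of B, through its real matrix in a basis of X. *)
Definition spectrum (R : realType) (d : nat) (X : {vspace 'cV[R]_d})
    (B : 'End(subvs_of X)) : set R[i] :=
  [set z | eigenvalue
     (map_mx (real_complex R) (passmx.mxof (vbasis fullv) (vbasis fullv) B)) z].

Definition angle_sum (R : realType) (d : nat) (X : {vspace 'cV[R]_d})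
    (B : 'End(subvs_of X)) (n : nat) (v : subvs_of X) : R :=
  \sum_(1 <= j < n.+1) angle (vsval (iter j.-1 B v)) (vsval (iter j B v)).

(* All sups, limsups and liminfs below are of real quantities in [0, n pi/2]
   resp. [0, pi/2], so the real-valued operators are meaningful whenever X is
   not 0. The term of index n = 0 plays no role in the limits. *)
Definition upper_inner (R : realType) (d : nat) (X : {vspace 'cV[R]_d})
    (B : 'End(subvs_of X)) : R :=
  limn_sup (fun n => n%:R^-1 * sup [set angle_sum B n v | v in [set v | v != 0]]).

Definition lower_inner (R : realType) (d : nat) (X : {vspace 'cV[R]_d})
    (B : 'End(subvs_of X)) : R :=
  limn_inf (fun n => n%:R^-1 * sup [set angle_sum B n v | v in [set v | v != 0]]).

Definition upper_outer (R : realType) (d : nat) (X : {vspace 'cV[R]_d})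
    (B : 'End(subvs_of X)) : R :=
  sup [set limn_sup (fun n => n%:R^-1 * angle_sum B n v) | v in [set v | v != 0]].

Definition lower_outer (R : realType) (d : nat) (X : {vspace 'cV[R]_d})
    (B : 'End(subvs_of X)) : R :=
  sup [set limn_inf (fun n => n%:R^-1 * angle_sum B n v) | v in [set v | v != 0]].

(* Main.v *)
Require Import Defs.
From HB Require Import structures.
From mathcomp Require Import all_boot all_order all_algebra.
From mathcomp Require Import complex.
From mathcomp Require Import ring lra zify.
From mathcomp Require Import all_classical all_reals all_analysis.

Set Implicit Arguments.
Unset Strict Implicit.
Unset Printing Implicit Defensive.

Import Order.TTheory GRing.Theory Num.Theory.
Import numFieldNormedType.Exports.
Local Open Scope classical_set_scope.
Local Open Scope ring_scope.

(** Write v = s + u with s in Xs and u in Xu. The spectral gap makes the orbit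
    of u dominate that of s exponentially: |A^n s| |u| <= C q^n |s| |A^n u| with
    q < 1 ([exponential_dichotomy]). Such a bound comes from choosing a number
    above the spectral radius of A on Xs, and one above that of its inverse on
    Xu, whose product is still less than 1, and from the fact that the powers of
    a complex matrix with all eigenvalues in |z| < t are O(t^n)
    ([mx_powers_le]). The angle depends uniformly continuously on the directions
    of its two arguments ([angle_stable]), so wherever one of the two components
    of A^j v is negligible, the angle between A^j v and A^(j+1) v may be
    replaced by the one for the other component.

    Outer values. If u != 0, then A^j s is eventually negligible, so the
    averages of the angles along the orbits of s + u and of u have difference
    tending to 0 ([asum_asymp]) and the same limes superior and inferior. Hence
    each value at v is a value at a nonzero vector of Xs or of Xu
    ([outer_max]).

    Inner values. Let S_X(n) be the supremum over X of the angle sums of length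
    n. It is subadditive, so by Fekete's lemma S_X(n) / n has a limit theta(X);
    in particular the upper and the lower inner values agree. That
    theta(Xs), theta(Xu) <= theta(R^d) is plain. Conversely, domination implies
    that every orbit has first a (possibly empty) phase in which the
    Xu-component is negligible, then a transition whose length is bounded
    independently of v, then a phase in which the Xs-component is negligible. So
    an angle sum of length n is at most S_Xs(a) + S_Xu(b) + n e + M with
    a + b <= n and M depending on e only ([asum_split]), which is at most
    n (max(theta(Xs), theta(Xu)) + 2 e) plus a constant ([inner_max]). *)

(** * Powers of matrices *)

Lemma ler_entry_sum (F : numDomainType) (m p : nat) (N : 'M[F]_(m, p)) i j :
  `|N i j| <= \sum_i \sum_j `|N i j|.
Proof.
rewrite (bigD1 i) //= (bigD1 j) //= -addrA lerDl addr_ge0 ?sumr_ge0 // => k _.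
by rewrite sumr_ge0.
Qed.

(** If a product of factors M - r annihilates N and |r| < t for each r, then the
    entries of M^n N are O(t^n): removing one factor, x_n = M^n N satisfies
    x_(n+1) = r x_n + y_n with y_n = M^n (M - r) N. *)
Lemma mx_powers_le_roots (F : numFieldType) (m p : nat) (M : 'M[F]_m.+1)
    (t : F) (rs : seq F) (N : 'M[F]_(m.+1, p)) :
  (forall r, r \in rs -> `|r| < t) ->
  horner_mx M (\prod_(r <- rs) ('X - r%:P)) *m N = 0 ->
  exists2 K : F, 0 <= K &
    forall n i j, `|(M ^+ n *m N) i j| <= K * t ^+ n.
Proof.
elim: rs N => [|r rs IH] N rt.
  rewrite big_nil rmorph1 mul1mx => ->; exists 0 => // n i j.
  by rewrite mulmx0 mxE normr0 mul0r.
rewrite big_cons mulrC rmorphM /= -mulmxA => MN.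
have rt1 : `|r| < t by rewrite rt ?mem_head.
have t0 : 0 < t by apply: le_lt_trans rt1.
have [||K K0 HK] := IH (horner_mx M ('X - r%:P) *m N).
- by move=> s sr; rewrite rt // inE sr orbT.
- by rewrite MN.
have d0 : 0 < t - `|r| by rewrite subr_gt0.
set S : F := \sum_i \sum_j `|N i j|.
have S0 : 0 <= S by apply: sumr_ge0 => i _; apply: sumr_ge0.
exists (S + K / (t - `|r|)); first by rewrite addr_ge0 // divr_ge0 // ltW.
elim=> [|n IHn] i j.
  rewrite expr0 mul1mx mulr1 (le_trans (ler_entry_sum N i j)) //.
  by rewrite lerDl divr_ge0 // ltW.
have -> : M ^+ n.+1 *m N = r *: (M ^+ n *m N) +
    M ^+ n *m (horner_mx M ('X - r%:P) *m N).
  rewrite rmorphB /= horner_mx_X horner_mx_C mulmxBl mulmxBr mul_scalar_mx.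
  by rewrite -scalemxAr addrC subrK exprSr mulmxA.
rewrite mxE [X in `|X + _|]mxE.
apply: le_trans (ler_normD _ _) _; rewrite normrM.
apply: le_trans (lerD (ler_wpM2l (normr_ge0 r) (IHn i j)) (HK n i j)) _.
rewrite exprSr [leRHS]mulrA [leRHS]mulrAC mulrA -mulrDl.
rewrite ler_wpM2r ?exprn_ge0 ?(ltW t0) //.
rewrite -subr_ge0.
have -> : (S + K / (t - `|r|)) * t - (`|r| * (S + K / (t - `|r|)) + K) =
  S * (t - `|r|) by field; rewrite gt_eqF.
by rewrite mulr_ge0 // ltW.
Qed.

(** The case N = 1, by the Cayley-Hamilton theorem. *)
Lemma mx_powers_le (F : numClosedFieldType) (m : nat) (M : 'M[F]_m) (t : F) :
  (forall z, eigenvalue M z -> `|z| < t) ->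
  exists2 K : F, 0 <= K & forall n i j, `|(M ^+ n) i j| <= K * t ^+ n.
Proof.
case: m M => [|m] M Mt; first by exists 0 => // n [].
have [rs Ers] := closed_field_poly_normal (char_poly M).
rewrite (monicP (char_poly_monic M)) scale1r in Ers.
have [||K K0 HK] := @mx_powers_le_roots F m m.+1 M t rs 1%:M.
- by move=> r rrs; rewrite Mt // eigenvalue_root_char Ers root_prod_XsubC.
- by rewrite -Ers mulmx1; apply: Cayley_Hamilton.
by exists K => // n i j; rewrite -[M ^+ n]mulmx1.
Qed.

Lemma eigenvalue_invmx (F : fieldType) (m : nat) (M : 'M[F]_m) z :
  M \in unitmx -> eigenvalue (invmx M) z -> z != 0 /\ eigenvalue M z^-1.
Proof.
move=> Mu /eigenvalueP[v vM v0].
have z0 : z != 0.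
  apply: contra_neq v0 => z0; move: vM; rewrite z0 scale0r.
  by move/(congr1 (mulmx^~ M)); rewrite mulmxKV // mul0mx.
split=> //; apply/eigenvalueP; exists v => //.
move/(congr1 (mulmx^~ M)): vM; rewrite mulmxKV // -scalemxAl => {2}->.
by rewrite scalerA mulVf // scale1r.
Qed.

(** * The Euclidean norm *)

Section EuclideanNorm.
Variables (R : realType) (d : nat).
Implicit Types (v w x y : 'cV[R]_d) (a : R).

Lemma dotpE v w : dotp v w = \sum_i v i ord0 * w i ord0.
Proof. by rewrite /dotp mxE; apply: eq_bigr => i _; rewrite mxE. Qed.

Lemma dotpC v w : dotp v w = dotp w v.
Proof. by rewrite !dotpE; apply: eq_bigr => i _; rewrite mulrC. Qed.

Lemma dotpDl x y w : dotp (x + y) w = dotp x w + dotp y w.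
Proof. by rewrite /dotp linearD mulmxDl mxE. Qed.

Lemma dotpZl a x w : dotp (a *: x) w = a * dotp x w.
Proof. by rewrite /dotp linearZ /= -scalemxAl mxE. Qed.

Lemma dotpDr w x y : dotp w (x + y) = dotp w x + dotp w y.
Proof. by rewrite dotpC dotpDl !(dotpC w). Qed.

Lemma dotpZr a w x : dotp w (a *: x) = a * dotp w x.
Proof. by rewrite dotpC dotpZl (dotpC w). Qed.

Lemma dotpBl x y w : dotp (x - y) w = dotp x w - dotp y w.
Proof. by rewrite dotpDl -scaleN1r dotpZl mulN1r. Qed.

Lemma dotpBr w x y : dotp w (x - y) = dotp w x - dotp w y.
Proof. by rewrite dotpC dotpBl !(dotpC w). Qed.

Lemma dotp_ge0 v : 0 <= dotp v v.
Proof. by rewrite dotpE sumr_ge0 // => i _; rewrite -expr2 sqr_ge0. Qed.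

Lemma enorm_ge0 v : 0 <= enorm v.
Proof. exact: sqrtr_ge0. Qed.

Lemma enorm_sqr v : enorm v ^+ 2 = dotp v v.
Proof. by rewrite sqr_sqrtr // dotp_ge0. Qed.

Lemma ler_entry_enorm v i : `|v i ord0| <= enorm v.
Proof.
rewrite -sqrtr_sqr ler_wsqrtr // dotpE (bigD1 i) //= expr2 lerDl.
by rewrite sumr_ge0 // => j _; rewrite -expr2 sqr_ge0.
Qed.

Lemma enorm_eq0 v : (enorm v == 0) = (v == 0).
Proof.
apply/eqP/eqP => [v0|->]; last by rewrite /enorm /dotp mulmx0 mxE sqrtr0.
apply/colP => i; rewrite mxE; apply/eqP; rewrite -normr_eq0.
by rewrite eq_le normr_ge0 andbT -v0 ler_entry_enorm.
Qed.

Lemma enorm0 : enorm (0 : 'cV[R]_d) = 0.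
Proof. by apply/eqP; rewrite enorm_eq0. Qed.

Lemma enorm_gt0 v : (0 < enorm v) = (v != 0).
Proof. by rewrite lt_def enorm_ge0 andbT enorm_eq0. Qed.

Lemma enormZ a v : enorm (a *: v) = `|a| * enorm v.
Proof.
by rewrite /enorm dotpZl dotpZr mulrA -expr2 sqrtrM ?sqr_ge0 // sqrtr_sqr.
Qed.

Lemma enormN v : enorm (- v) = enorm v.
Proof. by rewrite -scaleN1r enormZ normrN1 mul1r. Qed.

Lemma dotp_le v w : `|dotp v w| <= enorm v * enorm w.
Proof.
have [->|v0] := eqVneq v 0.
  by rewrite enorm0 /dotp trmx0 mul0mx mxE normr0 mul0r.
have [->|w0] := eqVneq w 0.
  by rewrite enorm0 /dotp mulmx0 mxE normr0 mulr0.
have H (s : R) : s ^+ 2 = 1 -> s * dotp v w <= enorm v * enorm w.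
  move=> s1; have := dotp_ge0 (enorm w *: v + (- s * enorm v) *: w).
  rewrite dotpDl !dotpDr !dotpZl !dotpZr (dotpC w v) -!enorm_sqr => H.
  have : 0 <= 2 * (enorm v * enorm w) * (enorm v * enorm w - s * dotp v w).
    move: s1 H; set D := dotp v w; set V := enorm v; set W := enorm w.
    move=> s1; have -> : W * (W * V ^+ 2) + W * (- s * V * D) +
       (- s * V * (W * D) + - s * V * (- s * V * W ^+ 2))
      = V ^+ 2 * W ^+ 2 * (1 + s ^+ 2) - 2 * s * V * W * D by ring.
    by rewrite s1 => H; lra.
  by rewrite pmulr_rge0 ?subr_ge0 // !mulr_gt0 ?enorm_gt0.
rewrite ler_norml lerNl -mulN1r !H ?sqrrN ?expr1n //=.
by rewrite -[leLHS]mul1r H ?expr1n.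
Qed.

Lemma ler_enormD v w : enorm (v + w) <= enorm v + enorm w.
Proof.
rewrite -(ler_pXn2r (ltn0Sn 1)) ?nnegrE ?addr_ge0 ?enorm_ge0 //.
rewrite sqrrD !enorm_sqr dotpDl !dotpDr (dotpC w v).
have := le_trans (ler_norm _) (dotp_le v w).
by lra.
Qed.

Lemma ler_enorm_sum (I : Type) (r : seq I) (F : I -> 'cV[R]_d) :
  enorm (\sum_(i <- r) F i) <= \sum_(i <- r) enorm (F i).
Proof.
elim: r => [|i r IH]; first by rewrite !big_nil enorm0.
by rewrite !big_cons (le_trans (ler_enormD _ _)) // lerD2l.
Qed.

Lemma ler_dist_enorm v w : `|enorm v - enorm w| <= enorm (v - w).
Proof.
rewrite ler_distl; apply/andP; split.
  rewrite lerBlDl -[enorm (v - w)]enormN opprB.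
  by rewrite (le_trans _ (ler_enormD _ _)) // subrK.
by rewrite (le_trans _ (ler_enormD _ _)) // addrC subrK.
Qed.

(** Linear functionals on a finite-dimensional space are bounded. *)
Lemma linear_form_bounded (f : 'cV[R]_d -> R) : scalar f ->
  exists2 C : R, 0 <= C & forall v, `|f v| <= C * enorm v.
Proof.
move=> flin; pose F : {linear 'cV[R]_d -> R^o} :=
  HB.pack f (GRing.isLinear.Build R _ R^o _ f flin).
exists (\sum_i `|f (delta_mx i ord0)|); first by rewrite sumr_ge0.
move=> v; have -> : f v = \sum_i v i ord0 * f (delta_mx i ord0).
  rewrite {1}[v]matrix_sum_delta -[LHS]/(F _) linear_sum; apply: eq_bigr => i _.
  by rewrite big_ord1 linearZ.
rewrite mulr_suml; apply: le_trans (ler_norm_sum _ _ _) _.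
apply: ler_sum => i _; rewrite normrM mulrC ler_wpM2l //.
exact: ler_entry_enorm.
Qed.

End EuclideanNorm.

(** * Exponential domination *)

Lemma normc_real (R : rcfType) (x : R) : `|x%:C%C| = `|x|%:C%C :> R[i].
Proof. by rewrite normc_def /= expr0n addr0 sqrtr_sqr. Qed.

(** The spectral radius, as a real number; it is 0 when there are no
    eigenvalues. *)
Lemma spectral_radius_ex (R : realType) (m : nat) (M : 'M[R[i]]_m) :
  exists2 a : R, 0 <= a & (forall z, eigenvalue M z -> `|z| <= a%:C%C) /\
    (a = 0 \/ exists2 z, eigenvalue M z & `|z| = a%:C%C).
Proof.
have [rs Ers] := closed_field_poly_normal (char_poly M).
rewrite (monicP (char_poly_monic M)) scale1r in Ers.
have Mrs z : eigenvalue M z = (z \in rs).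
  by rewrite eigenvalue_root_char Ers root_prod_XsubC.
suff [a a0 [H1 H2]] : exists2 a : R, 0 <= a &
    (forall z, z \in rs -> `|z| <= a%:C%C) /\
    (a = 0 \/ exists2 z, z \in rs & `|z| = a%:C%C).
  exists a => //; split=> [z|]; first by rewrite Mrs; apply: H1.
  by case: H2 => [|[z zrs za]]; [left | right; exists z; rewrite ?Mrs].
elim: rs {Ers Mrs} => [|r rs [a a0 [H1 H2]]].
  by exists 0 => //; split=> //; left.
have [b b0 rb] : exists2 b : R, 0 <= b & `|r| = b%:C%C.
  by exists (Num.sqrt ((complex.Re r)^+2 + (complex.Im r)^+2));
    rewrite ?sqrtr_ge0 // normc_def.
have [ab|/ltW ba] := leP a b.
  exists b => //; split; last by right; exists r; rewrite ?mem_head.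
  move=> z; rewrite inE => /orP[/eqP->|/H1 za]; first by rewrite rb.
  by apply: le_trans za _; rewrite lecR.
exists a => //; split; last first.
  by case: H2 => [|[z zrs za]]; [left | right; exists z];
    rewrite // inE zrs orbT.
move=> z; rewrite inE => /orP[/eqP->|/H1 za //].
by rewrite rb lecR.
Qed.

(** [mx_powers_le] for a real matrix with complex eigenvalues. *)
Lemma real_mx_powers_le (R : realType) (m : nat) (M : 'M[R]_m) (t : R) :
  (forall z, eigenvalue (map_mx (real_complex R) M) z -> `|z| < t%:C%C) ->
  exists2 K : R, 0 <= K & forall n i j, `|(M ^+ n) i j| <= K * t ^+ n.
Proof.
move=> /mx_powers_le[K K0 HK].
have [k k0 Kk] : exists2 k : R, 0 <= k & K = k%:C%C.
  exists (complex.Re K); last by rewrite RRe_real // ger0_real.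
  by move: K0; rewrite lecE => /andP[].
exists k => // n i j; rewrite -lecR -normc_real rmorphM rmorphXn /= -Kk.
have -> : ((M ^+ n) i j)%:C%C = (map_mx (real_complex R) M ^+ n) i j.
  elim: n i j => [|n IH] i j; first by rewrite !expr0 !mxE rmorph_nat.
  rewrite !exprS !mxE rmorph_sum; apply: eq_bigr => l _ /=.
  by rewrite rmorphM /= IH mxE.
exact: HK.
Qed.

Section Subspace.
Variables (R : realType) (d : nat) (X : {vspace 'cV[R]_d}).
Let b := vbasis {:subvs_of X}.
Let bP : basis_of {:subvs_of X} b. Proof. exact: vbasisP. Qed.

Lemma vsval_eq0 (v : subvs_of X) : (vsval v == 0) = (v == 0).
Proof. by rewrite -(inj_eq val_inj). Qed.

(** The coordinates in a basis of X are bounded by the Euclidean norm. *)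
Lemma coord_bounded : exists2 C : R, 0 <= C &
  forall (v : subvs_of X) i, `|passmx.rVof b v ord0 i| <= C * enorm (vsval v).
Proof.
have H i : exists2 C : R, 0 <= C &
    forall v : subvs_of X, `|passmx.rVof b v ord0 i| <= C * enorm (vsval v).
  have [|C C0 HC] := @linear_form_bounded R d (fun w => coord b i (vsproj X w)).
    by move=> a x y; rewrite !linearP.
  by exists C => // v; rewrite mxE -{1}[v]vsvalK; apply: HC.
have [C HC] := choice (fun i => let: ex_intro2 C C0 hC := H i in
   ex_intro (fun C => 0 <= C /\ _) C (conj C0 hC)).
exists (\sum_i C i); first by apply: sumr_ge0 => i _; case: (HC i).
move=> v i; apply: le_trans ((HC i).2 v) _.
rewrite ler_wpM2r ?enorm_ge0 // (bigD1 i) //= lerDl.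
by apply: sumr_ge0 => j _; case: (HC j).
Qed.

(** Let the eigenvalues of G lie in |z| < t. If w is the image of v under the
    n-th power of the endomorphism of X with matrix G, then |w| <= K t^n |v|,
    with K independent of n, v and w. *)
Lemma subspace_powers_le (G : 'M[R]_(\dim {:subvs_of X})) (t : R) :
  (forall z, eigenvalue (map_mx (real_complex R) G) z -> `|z| < t%:C%C) ->
  exists2 K : R, 0 <= K & forall n (v w : subvs_of X),
    passmx.rVof b w = passmx.rVof b v *m G ^+ n ->
    enorm (vsval w) <= K * t ^+ n * enorm (vsval v).
Proof.
move=> /real_mx_powers_le[K K0 HK]; have [C C0 HC] := coord_bounded.
set D := \dim _ in G HK *.
pose S := \sum_(i < D) \sum_(k < D) C * K * enorm (vsval b`_i).
exists S.
  by apply: sumr_ge0 => i _; apply: sumr_ge0 => k _;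
    rewrite !mulr_ge0 ?enorm_ge0.
move=> n v w E; rewrite -[w](passmx.rVofK bP) E /passmx.vecof linear_sum.
apply: le_trans (ler_enorm_sum _ _) _.
rewrite !mulr_suml; apply: ler_sum => i _.
rewrite linearZ /= enormZ mxE !mulr_suml.
apply: le_trans (ler_wpM2r (enorm_ge0 _) (ler_norm_sum _ _ _)) _.
rewrite mulr_suml; apply: ler_sum => k _; rewrite normrM.
have -> : C * K * enorm (vsval b`_i) * t ^+ n * enorm (vsval v) =
  (C * enorm (vsval v)) * (K * t ^+ n) * enorm (vsval b`_i) by ring.
by rewrite ler_wpM2r ?enorm_ge0 // ler_pM.
Qed.

End Subspace.

Section Dichotomy.
Variables (R : realType) (d : nat) (A : 'M[R]_d).

(** [orbit_at n v] is A^n v. *)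
Definition orbit_at n (v : 'cV[R]_d) := iter n (mulmx A) v.

Lemma iter_restrE (X : {vspace 'cV[R]_d}) (v : subvs_of X) n :
  invariant_subspace A X -> vsval (iter n (restr A X) v) = orbit_at n (vsval v).
Proof. by move=> AX; elim: n => //= n <-; rewrite restrE. Qed.

Lemma orbit_atD n v w : orbit_at n (v + w) = orbit_at n v + orbit_at n w.
Proof. by elim: n => //= n ->; rewrite mulmxDr. Qed.

Lemma orbit_at_in (X : {vspace 'cV[R]_d}) n v :
  invariant_subspace A X -> v \in X -> orbit_at n v \in X.
Proof. by move=> AX vX; elim: n => //= n; apply: AX. Qed.

Lemma orbit_at_neq0 n v : A \in unitmx -> v != 0 -> orbit_at n v != 0.
Proof.
move=> Au v0; elim: n => //= n; apply: contra_neq.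
move=> /(congr1 (mulmx (invmx A))).
by rewrite mulKmx // mulmx0.
Qed.

(** The orbits in Xu dominate those in Xs. On Xu the bound is the one for the
    powers of the inverse, applied to A^n u. *)
Lemma exponential_dichotomy (Xs Xu : {vspace 'cV[R]_d}) :
  A \in unitmx -> invariant_subspace A Xs -> invariant_subspace A Xu ->
  (forall lam mu : R[i], spectrum (restr A Xs) lam ->
     spectrum (restr A Xu) mu -> `|lam| < `|mu|) ->
  exists C q : R, [/\ 0 <= C, 0 <= q, q < 1 &
    forall n s u, s \in Xs -> u \in Xu ->
      enorm (orbit_at n s) * enorm u <=
        C * q ^+ n * (enorm s * enorm (orbit_at n u))].
Proof.
move=> Au As Aux gap.
pose bs := vbasis {:subvs_of Xs}; have bsP : basis_of _ bs := vbasisP _.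
pose bu := vbasis {:subvs_of Xu}; have buP : basis_of _ bu := vbasisP _.
pose Ms := passmx.mxof bs bs (restr A Xs).
pose Mu := passmx.mxof bu bu (restr A Xu).
have iterM (X : {vspace 'cV[R]_d}) n (v : subvs_of X)
    (b := vbasis {:subvs_of X}) :
  passmx.rVof b (iter n (restr A X) v) =
    passmx.rVof b v *m (passmx.mxof b b (restr A X)) ^+ n.
  elim: n => [|n IH]; first by rewrite expr0 mulmx1.
  by rewrite exprSr iterS (@passmx.rVof_app _ _ _ b b (vbasisP _)) IH -mulmxA.
have Muu : Mu \in unitmx.
  rewrite -row_free_unit; apply: inj_row_free => v.
  rewrite passmx.mul_mxof => /eqP; rewrite passmx.rVof_eq0 // => /eqP.
  move=> /(congr1 vsval); rewrite restrE // linear0.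
  move=> /(congr1 (mulmx (invmx A))); rewrite mulKmx // mulmx0.
  by move=> /eqP; rewrite vsval_eq0 passmx.vecof_eq0 // => /eqP.
pose Gu := invmx Mu.
pose cM m (M : 'M[R]_m) := map_mx (real_complex R) M.
have [a a0 [Ha1 Ha2]] := spectral_radius_ex (cM _ Ms).
have [b b0 [Hb1 Hb2]] := spectral_radius_ex (cM _ Gu).
have ab1 : a * b < 1.
  case: Ha2 => [->|[lam lamE lama]]; first by rewrite mul0r.
  case: Hb2 => [->|[z zE zb]]; first by rewrite mulr0.
  move: zE; rewrite /Gu /cM map_invmx => /eigenvalue_invmx[|z0 zE].
    by rewrite map_unitmx.
  rewrite -ltcR rmorphM /= -lama -zb -ltr_pdivlMr ?normr_gt0 // mul1r -normfV.
  exact: gap.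
(* Room between the spectral radii: 1 - a b > e (a + b + e). *)
have [e e0 eab] : exists2 e : R, 0 < e & (a + e) * (b + e) < 1.
  pose D := 2 * (a + b + 1).
  have D0 : 0 < D by rewrite /D; lra.
  pose e := Num.min 1 ((1 - a * b) / D).
  have e0 : 0 < e by rewrite /e lt_min ltr01 divr_gt0 // subr_gt0.
  have e1 : e <= 1 by rewrite /e ge_min lexx.
  have e2 : e * D <= 1 - a * b.
    by rewrite -ler_pdivlMr // /e ge_min lexx orbT.
  exists e => //.
  have : e * (a + b + e) <= e * (a + b + 1) by rewrite ler_pM2l // lerD2l.
  by move: e2; rewrite /D; nra.
have [z zE|Ks Ks0 HKs] := @subspace_powers_le R d Xs Ms (a + e).
  by apply: le_lt_trans (Ha1 z zE) _; rewrite ltcR ltrDl.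
have [z zE|Ku Ku0 HKu] := @subspace_powers_le R d Xu Gu (b + e).
  by apply: le_lt_trans (Hb1 z zE) _; rewrite ltcR ltrDl.
have ae0 : 0 <= a + e by rewrite addr_ge0 // ltW.
have be0 : 0 <= b + e by rewrite addr_ge0 // ltW.
exists (Ks * Ku), ((a + e) * (b + e)); split=> //; try exact: mulr_ge0.
move=> n s u sX uX.
have Hs := HKs n (vsproj Xs s) _ (iterM Xs n (vsproj Xs s)).
rewrite iter_restrE // vsprojK // in Hs.
have Hu : enorm u <= Ku * (b + e) ^+ n * enorm (orbit_at n u).
  have := HKu n (iter n (restr A Xu) (vsproj Xu u)) (vsproj Xu u).
  rewrite iter_restrE // vsprojK //; apply.
  rewrite iterM -/Mu -mulmxA.
  suff -> : Mu ^+ n *m Gu ^+ n = 1%:M by rewrite mulmx1.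
  elim: (n) => [|k IH]; first by rewrite !expr0 mulmx1.
  rewrite exprSr exprS -!mulmxE mulmxA -(mulmxA _ Mu) mulmxV //.
  by rewrite mulmx1 IH.
apply: le_trans (ler_pM (enorm_ge0 _) (enorm_ge0 _) Hs Hu) _.
by rewrite exprMn le_eqVlt; apply/orP; left; apply/eqP; ring.
Qed.

End Dichotomy.

(** * Continuity of the angle *)

Section Angle.
Variable R : realType.

Lemma ler_cos : {in `[0, pi] &, {mono (@cos R) : x y /~ y <= x}}.
Proof. by move=> x y xI yI; rewrite !leNgt ltr_cos. Qed.

(** A modulus of continuity for arccos: if b = cos y and a = cos (y + D) with
    0 <= y <= y + D <= pi / 2, then 1 - cos D <= b - a. *)
Lemma acos_dist (a b e : R) : 0 <= a -> b <= 1 -> a <= b -> 0 <= e <= pi ->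
  b - a < 1 - cos e -> `|acos a - acos b| <= e.
Proof.
move=> a0 b1 ab /andP[e0 epi] abe.
have aI : -1 <= a <= 1 by apply/andP; split; lra.
have bI : -1 <= b <= 1 by apply/andP; split; lra.
have acosI (c : R) : 0 <= c -> c <= 1 -> 0 <= acos c <= pi / 2.
  move=> c0 c1; have cI : -1 <= c <= 1 by apply/andP; split; lra.
  rewrite acos_ge0 //= -ler_cos ?in_itv /= ?acos_ge0 ?acos_lepi //.
    by rewrite acosK ?in_itv //= cos_pihalf.
  by have := pi_ge0 R; lra.
have b0 := le_trans a0 ab; have a1 := le_trans ab b1.
have /andP[x0 x1] := acosI a a0 a1; have /andP[y0 y1] := acosI b b0 b1.
have cx : cos (acos a) = a by rewrite acosK ?in_itv.
have cy : cos (acos b) = b by rewrite acosK ?in_itv.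
have yx : acos b <= acos a.
  rewrite -ler_cos ?in_itv /= ?acos_ge0 ?acos_lepi //.
  by rewrite cx cy.
move: x0 x1 y0 y1 cx cy yx; move: (acos a) (acos b) => x y x0 x1 y0 y1 cx cy yx.
rewrite ger0_norm ?subr_ge0 //.
have p0 := pi_ge0 R.
rewrite -ler_cos ?in_itv /=; [|apply/andP; split; lra..].
apply: ltW; rewrite -(ltrD2r (b - a - cos e)) addrCA subrr addr0.
apply: lt_le_trans abe _.
set D := x - y; have xE : x = y + D by rewrite /D; ring.
have D0 : 0 <= D by rewrite subr_ge0.
have D1 : D <= pi / 2 by rewrite /D; lra.
have sD : 0 <= sin D by rewrite sin_ge0_pi //; apply/andP; split; lra.
have cD : 0 <= cos D by rewrite cos_ge0_pihalf //; apply/andP; split; lra.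
have sy : 0 <= sin y by rewrite sin_ge0_pi //; apply/andP; split; lra.
have := cos2Dsin2 D; have := cos2Dsin2 y.
move: cx; rewrite xE cosD cy => <-.
have := cos_le1 D; have := sin_le1 D; have := sin_le1 y.
move: sD cD sy; move: (sin D) (cos D) (sin y) => S C T S0 C0 T0 T1 S1 C1 e1 e2.
(* b - cos (y + D) = b (1 - cos D) + sin y sin D >= (b + sin y) (1 - cos D),
   where b = cos y, because sin D + cos D >= 1, and b + sin y >= 1. *)
have h1 : 1 <= S + C by nra.
have h2 : 1 <= b + T by rewrite -e1; nra.
nra.
Qed.

Variable d : nat.
Implicit Types p q v w x y : 'cV[R]_d.

(** The unit vector in the direction of v, and 0 for v = 0. *)
Definition unit_dir v := (enorm v)^-1 *: v.

Lemma enorm_unit_dir v : enorm (unit_dir v) <= 1.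
Proof.
have [->|v0] := eqVneq v 0; first by rewrite /unit_dir scaler0 enorm0.
by rewrite enormZ ger0_norm ?invr_ge0 ?enorm_ge0 // mulVf // enorm_eq0.
Qed.

Lemma unit_dirK v : enorm v *: unit_dir v = v.
Proof.
have [->|v0] := eqVneq v 0; first by rewrite /unit_dir !scaler0.
by rewrite scalerA divff ?scale1r // enorm_eq0.
Qed.

Lemma angleE v w : angle v w = acos `|dotp (unit_dir v) (unit_dir w)|.
Proof.
rewrite /angle dotpZl dotpZr !normrM.
rewrite (ger0_norm (_ : 0 <= (enorm v)^-1)) ?invr_ge0 ?enorm_ge0 //.
rewrite (ger0_norm (_ : 0 <= (enorm w)^-1)) ?invr_ge0 ?enorm_ge0 //.
by rewrite mulrA -invfM mulrC.
Qed.

Lemma dotp_unit_dir_le1 v w : `|dotp (unit_dir v) (unit_dir w)| <= 1.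
Proof.
apply: le_trans (dotp_le _ _) _.
by rewrite mulr_ile1 ?enorm_ge0 ?enorm_unit_dir.
Qed.

Lemma angle_ge0 v w : 0 <= angle v w.
Proof.
rewrite angleE acos_ge0 // dotp_unit_dir_le1 andbT.
by apply: le_trans (normr_ge0 _); rewrite oppr_le0.
Qed.

Lemma angle_le v w : angle v w <= pi / 2.
Proof.
have c1 := dotp_unit_dir_le1 v w.
have c0 := normr_ge0 (dotp (unit_dir v) (unit_dir w)).
rewrite angleE; move: `|_| c0 c1 => c c0 c1.
have cI : -1 <= c <= 1 by apply/andP; split; lra.
rewrite -ler_cos ?in_itv /= ?acos_ge0 ?acos_lepi //.
  by rewrite acosK ?in_itv //= cos_pihalf.
by have := pi_ge0 R; lra.
Qed.

Lemma unit_dir_dist (h : R) x p : p != 0 -> enorm (x - p) <= h * enorm p ->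
  enorm (unit_dir x - unit_dir p) <= 2 * h.
Proof.
move=> p0 xp; have np : 0 < enorm p by rewrite enorm_gt0.
have E : enorm p *: (unit_dir x - unit_dir p) =
    (enorm p - enorm x) *: unit_dir x + (x - p).
  by rewrite scalerBr scalerBl !unit_dirK addrA subrK.
rewrite -(ler_pM2l np) -[X in X * _ <= _]ger0_norm ?enorm_ge0 // -enormZ E.
apply: le_trans (ler_enormD _ _) _; rewrite enormZ.
have := ler_dist_enorm p x; rewrite -[enorm (p - x)]enormN opprB => pxd.
have : `|enorm p - enorm x| * enorm (unit_dir x) <= `|enorm p - enorm x|.
  by rewrite ler_piMr // enorm_unit_dir.
by lra.
Qed.

(** The angle is uniformly continuous in the directions of its arguments. *)
Lemma angle_stable (e : R) : 0 < e -> exists2 h : R, 0 < h &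
  forall x y p q, p != 0 -> q != 0 ->
    enorm (x - p) <= h * enorm p -> enorm (y - q) <= h * enorm q ->
    `|angle x y - angle p q| <= e.
Proof.
move=> e0.
(* Capping e at 1 keeps it in the range where cos is decreasing. *)
pose f := Num.min e 1.
have f0 : 0 < f by rewrite lt_min e0 ltr01.
have fe : f <= e by rewrite ge_min lexx.
have fpi : f <= pi.
  have f1 : f <= 1 by rewrite ge_min lexx orbT.
  by have := pi_ge2 R; lra.
have cf : cos f < 1.
  by rewrite -cos0 ltr_cos ?in_itv /= ?lexx ?pi_ge0 ?fpi ?andbT ?(ltW f0).
(* Both unit vectors move by at most 2 h, so the cosine moves by at most
   4 h = (1 - cos f) / 2. *)
exists ((1 - cos f) / 8); first by rewrite divr_gt0 // subr_gt0.
move=> x y p q p0 q0 xp yq; apply: le_trans fe.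
have := unit_dir_dist p0 xp; have := unit_dir_dist q0 yq.
rewrite !angleE.
have c1 := dotp_unit_dir_le1 x y; have c2 := dotp_unit_dir_le1 p q.
move=> yqd xpd.
have : `| `|dotp (unit_dir x) (unit_dir y)|
          - `|dotp (unit_dir p) (unit_dir q)| | < 1 - cos f.
  apply: le_lt_trans (ler_dist_dist _ _) _.
  have -> : dotp (unit_dir x) (unit_dir y) - dotp (unit_dir p) (unit_dir q) =
    dotp (unit_dir x - unit_dir p) (unit_dir y) +
    dotp (unit_dir p) (unit_dir y - unit_dir q).
    by rewrite dotpBl dotpBr addrA subrK.
  apply: le_lt_trans (ler_normD _ _) _.
  have h1 := dotp_le (unit_dir x - unit_dir p) (unit_dir y).
  have h2 := dotp_le (unit_dir p) (unit_dir y - unit_dir q).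
  have h3 := ler_wpM2l (enorm_ge0 (unit_dir x - unit_dir p)) (enorm_unit_dir y).
  have h4 := ler_wpM2r (enorm_ge0 (unit_dir y - unit_dir q)) (enorm_unit_dir p).
  by lra.
move: c1 c2 (normr_ge0 (dotp (unit_dir x) (unit_dir y)))
  (normr_ge0 (dotp (unit_dir p) (unit_dir q))).
move: `|dotp _ _| `|dotp _ _| => b a a1 b1 a0 b0 ab.
have fI : 0 <= f <= pi by rewrite (ltW f0).
have [le_ab|/ltW le_ba] := leP a b.
  by apply: acos_dist => //; apply: le_lt_trans ab; rewrite distrC ler_norm.
rewrite distrC; apply: acos_dist => //.
by apply: le_lt_trans ab; rewrite ler_norm.
Qed.

End Angle.

(** * Sums of angles along orbits *)

Section AngleSums.
Variables (R : realType) (d : nat) (A : 'M[R]_d).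
Implicit Types (v w s u : 'cV[R]_d) (X : {vspace 'cV[R]_d}).

(** The sum of the first n angles along the orbit of v in R^d. *)
Definition asum n v : R :=
  \sum_(j < n) angle (orbit_at A j v) (orbit_at A j.+1 v).

Lemma angle_sumE X (v : subvs_of X) n : invariant_subspace A X ->
  angle_sum (restr A X) n v = asum n (vsval v).
Proof.
move=> AX; rewrite /angle_sum big_add1 big_mkord; apply: eq_bigr => j _.
by rewrite !iter_restrE.
Qed.

Lemma orbit_at_add m n v : orbit_at A (m + n) v = orbit_at A n (orbit_at A m v).
Proof. by rewrite addnC /orbit_at iterD. Qed.

Lemma asumD m n v : asum (m + n) v = asum m v + asum n (orbit_at A m v).
Proof.
rewrite /asum big_split_ord /=; congr (_ + _); apply: eq_bigr => j _ /=.
by rewrite -!orbit_at_add.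
Qed.

Lemma asum_ge0 n v : 0 <= asum n v.
Proof. by apply: sumr_ge0 => j _; apply: angle_ge0. Qed.

Lemma asum_le n v : asum n v <= n%:R * (pi / 2).
Proof.
rewrite -[n in n%:R]card_ord mulr_natl -sumr_const.
by apply: ler_sum => j _; apply: angle_le.
Qed.

Lemma asum_leq_le m n v : (m <= n)%N -> asum m v <= n%:R * (pi / 2).
Proof.
move=> mn; apply: le_trans (asum_le m v) _.
by rewrite ler_wpM2r ?ler_nat // divr_ge0 // pi_ge0.
Qed.

(** Adding to v a vector w whose orbit is negligible against that of v changes
    each angle by at most e. *)
Lemma asum_close (e : R) : A \in unitmx -> 0 < e -> exists2 h : R, 0 < h &
  forall n v w, v != 0 -> (forall j, (j <= n)%N ->
      enorm (orbit_at A j w) <= h * enorm (orbit_at A j v)) ->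
    `|asum n (v + w) - asum n v| <= n%:R * e.
Proof.
move=> Au e0; have [h h0 H] := angle_stable d e0; exists h => // n v w v0 Hw.
rewrite /asum -sumrB; apply: le_trans (ler_norm_sum _ _ _) _.
rewrite -[n in n%:R]card_ord mulr_natl -sumr_const; apply: ler_sum => j _.
apply: H; rewrite ?orbit_at_neq0 //.
  by rewrite orbit_atD addrC addKr Hw // ltnW.
by rewrite orbit_atD addrC addKr Hw.
Qed.

Variables Xs Xu : {vspace 'cV[R]_d}.
Hypotheses (Au : A \in unitmx) (As : invariant_subspace A Xs)
  (AXu : invariant_subspace A Xu).
Hypothesis gap : forall lam mu : R[i], spectrum (restr A Xs) lam ->
     spectrum (restr A Xu) mu -> `|lam| < `|mu|.

Lemma geometric_lt (C q e : R) : 0 <= q -> q < 1 -> 0 < e ->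
  exists N, forall n, (N <= n)%N -> C * q ^+ n < e.
Proof.
move=> q0 q1 e0.
have : C * q ^+ n @[n --> \oo] --> (0 : R).
  rewrite -[0](mulr0 C); apply: cvgM; first exact: cvg_cst.
  by apply: cvg_expr; rewrite ger0_norm.
move/cvgrPdist_lt => /(_ e e0)[N _ HN]; exists N => n Nn.
have := HN n Nn; rewrite /= sub0r normrN; apply: le_lt_trans.
exact: ler_norm.
Qed.

(** Along the orbit of s + u with u != 0 there is a time k, depending on the
    orbit, before which the component in Xu is negligible and after which, with
    a uniform delay N, the component in Xs is. *)
Lemma domination_phases (h : R) : 0 < h -> exists N, forall s u,
  s \in Xs -> u \in Xu -> u != 0 -> exists k,
    (forall j, (j < k)%N ->
       enorm (orbit_at A j u) <= h * enorm (orbit_at A j s)) /\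
    (forall j, (k + N <= j)%N ->
       enorm (orbit_at A j s) <= h * enorm (orbit_at A j u)).
Proof.
move=> h0; have [C [q [C0 q0 q1 Hdich]]] := exponential_dichotomy Au As AXu gap.
have [N HN] := geometric_lt C q0 q1 (mulr_gt0 h0 h0); exists N => s u sX uX u0.
have nu0 n : 0 < enorm (orbit_at A n u) by rewrite enorm_gt0 orbit_at_neq0.
have exk : exists k, h * enorm (orbit_at A k s) < enorm (orbit_at A k u).
  have [k Hk] := geometric_lt (C * (h * enorm s)) q0 q1 (nu0 0%N).
  exists k; have := ler_wpM2l (ltW h0) (Hdich k s u sX uX).
  have := Hk k (leqnn k).
  rewrite -(ltr_pM2r (nu0 k)) [orbit_at A 0 u]/= => h1 h2.
  have nu : 0 < enorm u := nu0 0%N.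
  by rewrite -(ltr_pM2r nu); lra.
(* The first time at which the component in Xu is not negligible. *)
case: (ex_minnP exk) => k Hk kmin; exists k; split.
  move=> j jk; rewrite leNgt; apply/negP => /kmin; by rewrite leqNgt jk.
move=> j kj; have [m jE Nm] : exists2 m, j = (k + m)%N & (N <= m)%N.
  exists (j - k)%N; last by rewrite leq_subRL // (leq_trans _ kj) // leq_addr.
  by rewrite subnKC // (leq_trans _ kj) // leq_addr.
have := Hdich m _ _ (orbit_at_in k As sX) (orbit_at_in k AXu uX).
rewrite -!orbit_at_add -jE => H.
rewrite -(ler_pM2r (nu0 k)); apply: le_trans H _.
apply: le_trans (_ : _ <= h * h *
  (enorm (orbit_at A k s) * enorm (orbit_at A j u))) _.
  by rewrite ler_wpM2r ?mulr_ge0 ?enorm_ge0 // ltW // HN.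
have H2 := ler_wpM2l (mulr_ge0 (ltW h0) (ltW (nu0 j))) (ltW Hk).
by move: H2; lra.
Qed.

(** Up to a bounded transition phase and an error of e per step, the angle sum
    of s + u is at most an angle sum in Xs plus one in Xu, of total length at
    most n. *)
Lemma asum_split (e : R) : 0 < e -> exists2 M : R, 0 <= M & forall n s u,
  s \in Xs -> u \in Xu -> s != 0 -> u != 0 ->
  exists a b u', [/\ (a + b <= n)%N, u' \in Xu, u' != 0 &
    asum n (s + u) <= asum a s + asum b u' + n%:R * e + M].
Proof.
move=> e0; have [h h0 Hc] := asum_close Au e0.
have [N HN] := domination_phases h0.
have p0 : 0 <= pi / 2 :> R by rewrite divr_ge0 // pi_ge0.
exists (N.+1%:R * (pi / 2)); first by rewrite mulr_ge0.
move=> n s u sX uX s0 u0; have [k [Hs Hu]] := HN s u sX uX u0.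
(* An angle involves two consecutive times, hence k.-1. *)
pose a := minn n k.-1; pose b := minn n (k + N).
have ab : (a <= b)%N.
  rewrite leq_min geq_minl /= (leq_trans (geq_minr _ _)) //.
  by rewrite (leq_trans (leq_pred k)) // leq_addr.
have bn : (b <= n)%N by apply: geq_minl.
exists a, (n - b)%N, (orbit_at A b u); split.
- by rewrite -{2}(subnKC bn) leq_add2r.
- exact: orbit_at_in.
- exact: orbit_at_neq0.
have nE : n = (a + (b - a) + (n - b))%N by rewrite subnKC // subnKC.
rewrite {1}nE !asumD (subnKC ab).
have Ha : asum a (s + u) <= asum a s + a%:R * e.
  have [a0|a0] := posnP a; first by rewrite a0 /asum !big_ord0 mul0r addr0.
  have := Hc a s u s0; rewrite ler_distl => /(_ _)/andP[|_ //].
  move=> j ja; apply: Hs; apply: leq_ltn_trans ja _.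
  move: a0; rewrite /a leq_min => /andP[_].
  by case: (k) => // k' _; rewrite ltnS geq_minr.
have Hb : asum (n - b) (orbit_at A b (s + u)) <=
    asum (n - b) (orbit_at A b u) + (n - b)%:R * e.
  have [a0|a0] := posnP (n - b).
    by rewrite a0 /asum !big_ord0 mul0r addr0.
  have := Hc (n - b)%N _ (orbit_at A b s) (orbit_at_neq0 b Au u0).
  rewrite -orbit_atD (addrC u) ler_distl => /(_ _)/andP[|_ //].
  move=> j _; rewrite -!orbit_at_add; apply: Hu.
  move: a0; rewrite subn_gt0 /b gtn_min ltnn /= => kn.
  by rewrite (minn_idPr (ltnW kn)) leq_addr.
have Hm : asum (b - a) (orbit_at A a (s + u)) <= N.+1%:R * (pi / 2).
  apply: asum_leq_le; rewrite leq_subLR /a /b.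
  by clear; case: (leqP n k.-1); case: (leqP n (k + N)); lia.
have Hn : a%:R * e + (n - b)%:R * e <= n%:R * e.
  by rewrite -mulrDl -natrD ler_wpM2r ?(ltW e0) //
    ler_nat -{2}(subnKC bn) leq_add2r.
by lra.
Qed.

(** Orbits with a nonzero component in Xu have asymptotically the same angles
    as the orbit of that component. *)
Lemma asum_asymp (e : R) s u : s \in Xs -> u \in Xu -> u != 0 -> 0 < e ->
  exists M : R, forall n, `|asum n (s + u) - asum n u| <= n%:R * e + M.
Proof.
move=> sX uX u0 e0; have [h h0 Hc] := asum_close Au e0.
have [N HN] := domination_phases h0; have [k [_ Hu]] := HN s u sX uX u0.
exists ((k + N)%:R * (pi / 2)) => n; pose b := minn n (k + N).
have bn : (b <= n)%N by apply: geq_minl.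
have bk : (b <= k + N)%N by apply: geq_minr.
rewrite -{1 2}(subnKC bn) !asumD.
have Hb : `|asum (n - b) (orbit_at A b (s + u)) -
    asum (n - b) (orbit_at A b u)| <= (n - b)%:R * e.
  have [a0|a0] := posnP (n - b).
    by rewrite a0 /asum !big_ord0 mul0r subrr normr0.
  rewrite orbit_atD (addrC (orbit_at A b s)).
  apply: Hc; first exact: orbit_at_neq0.
  move=> j _; rewrite -!orbit_at_add; apply: Hu.
  move: a0; rewrite subn_gt0 /b gtn_min ltnn /= => kn.
  by rewrite (minn_idPr (ltnW kn)) leq_addr.
have Hn : (n - b)%:R * e <= n%:R * e.
  by rewrite ler_wpM2r ?(ltW e0) // ler_nat leq_subr.
have h1 := asum_leq_le (s + u) bk; have h2 := asum_leq_le u bk.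
have h3 := asum_ge0 b (s + u); have h4 := asum_ge0 b u.
move: Hb; rewrite !ler_norml => /andP[h5 h6].
by apply/andP; split; lra.
Qed.

End AngleSums.

(** * Averages of real sequences *)

Section Sequences.
Variable R : realType.
Implicit Types (T x y : nat -> R) (theta B : R).

(** Fekete's lemma for a subadditive sequence 0 <= T n <= n B, with
    theta = inf_(n > 0) T n / n. *)
Lemma fekete T B : 0 <= B -> (forall m n, T (m + n)%N <= T m + T n) ->
  (forall n, 0 <= T n <= n%:R * B) ->
  exists theta, [/\ 0 <= theta, forall n, n%:R * theta <= T n &
    forall e, 0 < e -> exists2 M, 0 <= M &
      forall n, T n <= n%:R * (theta + e) + M].
Proof.
move=> B0 Tsub TB.
pose E := [set (n.+1%:R^-1 * T n.+1 : R) | n in [set: nat]].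
have E0 : E !=set0 by exists (1%:R^-1 * T 1%N); exists 0%N.
have lbE : lbound E 0.
  by move=> _ [n _ <-]; rewrite mulr_ge0 // ?invr_ge0 //; case/andP: (TB n.+1).
exists (inf E); split; first exact: lb_le_inf.
  case=> [|n]; first by rewrite mul0r; case/andP: (TB 0%N).
  rewrite -ler_pdivlMl // ; apply: ge_inf; first by exists 0.
  by exists n.
move=> e e0; have [_ [m _ <-] me] : exists2 z, E z & z < inf E + e.
  by apply: inf_adherent => //; split=> //; exists 0.
rewrite ltr_pdivrMl // in me.
exists (m.+1%:R * B); first by rewrite mulr_ge0.
have Tmul q : T (q * m.+1)%N <= q%:R * T m.+1.
  elim: q => [|q IH].
    by rewrite mul0r; case/andP: (TB 0%N); rewrite mul0r mul0n.
  by rewrite mulSn (le_trans (Tsub _ _)) // -natr1 mulrDl mul1r addrC lerD2r.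
move=> n; rewrite {1}(divn_eq n m.+1); apply: le_trans (Tsub _ _) _.
apply: lerD.
  apply: le_trans (Tmul _) _.
  have : (n %/ m.+1)%:R * T m.+1 <= (n %/ m.+1)%:R * (m.+1%:R * (inf E + e)).
    by rewrite ler_wpM2l // ltW.
  move=> H; apply: le_trans H _; rewrite mulrA -natrM.
  rewrite ler_wpM2r ?ler_nat ?leq_divM //.
  by rewrite addr_ge0 ?(ltW e0) // lb_le_inf.
case/andP: (TB (n %% m.+1)%N) => _ H; apply: le_trans H _.
by rewrite ler_wpM2r // ler_nat ltnW // ltn_mod.
Qed.

(** The form in which convergence of averages is used: T n = n theta + o(n). *)
Lemma avg_cvg T theta : (forall e, 0 < e -> exists M : R, forall n,
    `|T n - n%:R * theta| <= n%:R * e + M) ->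
  (n%:R^-1 * T n) @[n --> \oo] --> theta.
Proof.
move=> H; apply/cvgrPdist_le => e e0.
have [|M HM] := H (e / 2); first by rewrite divr_gt0.
have [N _ HN] : \forall n \near \oo, `|M| * (2 / e) <= n%:R.
  exact: nbhs_infty_ger.
exists N.+1 => // n /= Nn.
have n0 : 0 < n%:R :> R by rewrite ltr0n (leq_trans _ Nn).
have := HN n (ltnW Nn); rewrite mulrA ler_pdivrMr // => HnM.
have -> : theta - n%:R^-1 * T n = n%:R^-1 * (n%:R * theta - T n).
  by rewrite mulrBr mulKf // gt_eqF.
rewrite normrM ger0_norm ?invr_ge0 ?(ltW n0) // distrC ler_pdivrMl //.
apply: le_trans (HM n) _; have := ler_norm M; lra.
Qed.

Lemma bounded_fun_ge0 x B : (forall n, 0 <= x n <= B) ->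
  bounded_fun (x : nat -> R^o).
Proof.
move=> xB; exists B; split; first exact: num_real.
move=> C BC n _ /=; case/andP: (xB n) => x0 x1.
by rewrite ger0_norm // (le_trans x1) // ltW.
Qed.

Lemma limn_sup_le x B : (forall n, 0 <= x n <= B) -> limn_sup x <= B.
Proof.
move=> xB; have bx := bounded_fun_ge0 xB.
rewrite limn_supE //; apply: (@le_trans _ _ (sups x 0%N)).
  by apply: ge_inf; [exact: bounded_fun_has_lbound_sups | exists 0%N].
apply: ge_sup; first by exists (x 0%N); exists 0%N.
by move=> _ [n _ <-]; case/andP: (xB n).
Qed.

Lemma limn_inf_le x B : (forall n, 0 <= x n <= B) -> limn_inf x <= B.
Proof.
move=> xB; have bx := bounded_fun_ge0 xB.
rewrite limn_infE //; apply: ge_sup; first by exists (infs x 0%N); exists 0%N.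
move=> _ [n _ <-]; apply: (@le_trans _ _ (x n)); last by case/andP: (xB n).
by apply: ge_inf;
  [apply/has_lbound_sdrop/bounded_fun_has_lbound | exists n => /=].
Qed.

Lemma limn_sup_asymp x y B :
  (forall n, 0 <= x n <= B) -> (forall n, 0 <= y n <= B) ->
  (x n - y n) @[n --> \oo] --> (0 : R) -> limn_sup x = limn_sup y.
Proof.
suff H u v : (forall n, 0 <= u n <= B) -> (forall n, 0 <= v n <= B) ->
    (u n - v n) @[n --> \oo] --> (0 : R) -> limn_sup u <= limn_sup v.
  move=> xB yB xy; apply/eqP; rewrite eq_le !H //.
  rewrite -oppr0 [X in X @ _](_ : _ = fun n => - (x n - y n)).
    exact: cvgN.
  by apply/funext => n; rewrite opprB.
move=> uB vB uv; have [_ E] := cvg_limn_inf_sup uv.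
have -> : u = (v \+ (fun n => u n - v n)).
  by apply/funext => n /=; rewrite addrC subrK.
apply: le_trans (le_limn_supD _ _) _; last by rewrite E addr0.
  exact: bounded_fun_ge0 vB.
by apply: cvg_seq_bounded; apply/cvg_ex; exists 0.
Qed.

Lemma limn_inf_asymp x y B :
  (forall n, 0 <= x n <= B) -> (forall n, 0 <= y n <= B) ->
  (x n - y n) @[n --> \oo] --> (0 : R) -> limn_inf x = limn_inf y.
Proof.
suff H u v : (forall n, 0 <= u n <= B) -> (forall n, 0 <= v n <= B) ->
    (u n - v n) @[n --> \oo] --> (0 : R) -> limn_inf v <= limn_inf u.
  move=> xB yB xy; apply/eqP; rewrite eq_le !H //.
  rewrite -oppr0 [X in X @ _](_ : _ = fun n => - (x n - y n)).
    exact: cvgN.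
  by apply/funext => n; rewrite opprB.
move=> uB vB uv; have [E _] := cvg_limn_inf_sup uv.
have -> : u = (v \+ (fun n => u n - v n)).
  by apply/funext => n /=; rewrite addrC subrK.
apply: le_trans (le_limn_infD _ _); first by rewrite E addr0.
  exact: bounded_fun_ge0 vB.
by apply: cvg_seq_bounded; apply/cvg_ex; exists 0.
Qed.

End Sequences.

(** * Angular values *)

Section AngularValues.
Variables (R : realType) (d : nat) (A : 'M[R]_d).
Implicit Type X : {vspace 'cV[R]_d}.

(** The supremum in the definition of the inner angular values. *)
Definition sup_asum X (n : nat) : R :=
  sup [set angle_sum (restr A X) n v | v in [set v : subvs_of X | v != 0]].

Lemma image_subvs_nonzero (T : Type) X (F : 'cV[R]_d -> T) :
  [set F (vsval v) | v in [set v : subvs_of X | v != 0]] =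
  [set F w | w in [set w | w \in X /\ w != 0]].
Proof.
apply/seteqP; split=> _ [v v0 <-].
  by exists (vsval v) => //; split; rewrite ?subvsP // vsval_eq0.
case: v0 => vX v0; exists (vsproj X v); last by rewrite vsprojK.
by rewrite /= -vsval_eq0 vsprojK.
Qed.

Lemma nonzero_vector_ex X : X != 0%VS -> exists w, w \in X /\ w != 0.
Proof. by move=> X0; exists (vpick X); rewrite memv_pick vpick0. Qed.

Lemma sup_asumE X n : invariant_subspace A X ->
  sup_asum X n = sup [set asum A n w | w in [set w | w \in X /\ w != 0]].
Proof.
move=> AX; rewrite -image_subvs_nonzero; congr sup.
by apply: eq_imagel => v _; apply: angle_sumE.
Qed.

Lemma sup_asum_ub X n w : invariant_subspace A X -> w \in X -> w != 0 ->
  asum A n w <= sup_asum X n.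
Proof.
move=> AX wX w0; rewrite sup_asumE //; apply: ub_le_sup; last by exists w.
by exists (n%:R * (pi / 2)) => _ [v _ <-]; apply: asum_le.
Qed.

Lemma sup_asum_le X n (c : R) : invariant_subspace A X -> X != 0%VS ->
  (forall w, w \in X -> w != 0 -> asum A n w <= c) -> sup_asum X n <= c.
Proof.
move=> AX X0 H; rewrite sup_asumE //; apply: ge_sup.
  by have [w wX] := nonzero_vector_ex X0; exists (asum A n w), w.
by move=> _ [w [wX w0] <-]; apply: H.
Qed.

(** The suprema grow linearly, at a rate theta approached from above. *)
Lemma inner_rate X : A \in unitmx -> invariant_subspace A X -> X != 0%VS ->
  exists theta : R, [/\ 0 <= theta, forall n, n%:R * theta <= sup_asum X n &
    forall e, 0 < e -> exists2 M, 0 <= M &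
      forall n, sup_asum X n <= n%:R * (theta + e) + M].
Proof.
move=> Au AX X0; apply: (@fekete R (sup_asum X) (pi / 2)).
- by rewrite divr_ge0 // pi_ge0.
- move=> m n; apply: sup_asum_le => // w wX w0; rewrite asumD.
  by rewrite lerD // sup_asum_ub ?orbit_at_in ?orbit_at_neq0.
- move=> n; apply/andP; split.
    have [w [wX w0]] := nonzero_vector_ex X0.
    exact: le_trans (asum_ge0 A n w) (sup_asum_ub n AX wX w0).
  by apply: sup_asum_le => // w _ _; apply: asum_le.
Qed.

Lemma inner_rate_cvg X (theta : R) :
  (forall n, n%:R * theta <= sup_asum X n) ->
  (forall e : R, 0 < e -> exists2 M, 0 <= M &
      forall n, sup_asum X n <= n%:R * (theta + e) + M) ->
  upper_inner (restr A X) = theta /\ lower_inner (restr A X) = theta.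
Proof.
move=> lo up; have H : (n%:R^-1 * sup_asum X n) @[n --> \oo] --> theta.
  apply: avg_cvg => e e0; have [M _ HM] := up e e0; exists M => n.
  rewrite ger0_norm ?subr_ge0 //; have := HM n; lra.
by have [loE upE] := cvg_limn_inf_sup H; split.
Qed.

Variables Xs Xu : {vspace 'cV[R]_d}.
Hypotheses (Au : A \in unitmx) (Xsu : (Xs + Xu)%VS = fullv)
  (Xs0 : Xs != 0%VS) (Xu0 : Xu != 0%VS)
  (As : invariant_subspace A Xs) (AXu : invariant_subspace A Xu).
Hypothesis gap : forall lam mu : R[i], spectrum (restr A Xs) lam ->
     spectrum (restr A Xu) mu -> `|lam| < `|mu|.

Let Afull : invariant_subspace A fullv.
Proof. by move=> w _; rewrite memvf. Qed.

Lemma fullv_neq0 : (fullv : {vspace 'cV[R]_d}) != 0%VS.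
Proof.
by apply: contra_neq Xs0 => f0; apply/eqP; rewrite -subv0 -f0 subvf.
Qed.

Lemma decomposition w : exists s u, [/\ s \in Xs, u \in Xu & w = s + u].
Proof.
have : w \in (Xs + Xu)%VS by rewrite Xsu memvf.
by case/memv_addP => s sX [u uX ->]; exists s, u.
Qed.

Lemma inner_max :
  upper_inner (restr A fullv) =
    Num.max (upper_inner (restr A Xs)) (upper_inner (restr A Xu)) /\
  lower_inner (restr A fullv) =
    Num.max (lower_inner (restr A Xs)) (lower_inner (restr A Xu)).
Proof.
have [ts [ts0 slo sup_]] := inner_rate Au As Xs0.
have [tu [tu0 ulo uup]] := inner_rate Au AXu Xu0.
have [-> ->] := inner_rate_cvg slo sup_; have [-> ->] := inner_rate_cvg ulo uup.
apply: inner_rate_cvg.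
  move=> n; have [_|_] := leP ts tu.
    apply: le_trans (ulo n) _; apply: sup_asum_le => // w _ w0.
    by apply: sup_asum_ub; rewrite ?memvf.
  apply: le_trans (slo n) _; apply: sup_asum_le => // w _ w0.
  by apply: sup_asum_ub; rewrite ?memvf.
move=> e e0; have e2 : 0 < e / 2 by rewrite divr_gt0.
have [Ms Ms0 HMs] := sup_ _ e2; have [Mu Mu0 HMu] := uup _ e2.
have [M M0 HM] := asum_split Au As AXu gap e2.
set t := Num.max ts tu.
have tst : ts <= t by rewrite le_max lexx.
have tut : tu <= t by rewrite le_max lexx orbT.
exists (Ms + Mu + M); first by rewrite !addr_ge0.
have Hs n w : w \in Xs -> w != 0 -> asum A n w <= n%:R * (t + e / 2) + Ms.
  move=> wX w0; apply: le_trans (sup_asum_ub n As wX w0) _.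
  by apply: le_trans (HMs n) _; rewrite lerD2r ler_wpM2l // lerD2r.
have Hu n w : w \in Xu -> w != 0 -> asum A n w <= n%:R * (t + e / 2) + Mu.
  move=> wX w0; apply: le_trans (sup_asum_ub n AXu wX w0) _.
  by apply: le_trans (HMu n) _; rewrite lerD2r ler_wpM2l // lerD2r.
move=> n; apply: sup_asum_le => //; first exact: fullv_neq0.
move=> w _; have [s [u [sX uX ->]]] := decomposition w.
have ne : 0 <= n%:R * (e / 2) by rewrite mulr_ge0 // ltW.
have [->|s0] := eqVneq s 0.
  by rewrite add0r => u0; have := Hu n u uX u0; lra.
have [->|u0] := eqVneq u 0.
  by rewrite addr0 => _; have := Hs n s sX s0; lra.
move=> _; have [a [b [u' [abn u'X u'0 H]]]] := HM n s u sX uX s0 u0.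
have := Hs a s sX s0; have := Hu b u' u'X u'0.
have : (a + b)%:R * (t + e / 2) <= n%:R * (t + e / 2).
  by rewrite ler_wpM2r ?ler_nat // addr_ge0 ?(ltW e2) // (le_trans ts0).
rewrite natrD; lra.
Qed.

(** Common to the upper and lower outer angular values, with L the limes
    superior and the limes inferior respectively. *)
Lemma outer_max (L : (nat -> R) -> R) :
  (forall x (B : R), (forall n, 0 <= x n <= B) -> L x <= B) ->
  (forall x y (B : R), (forall n, 0 <= x n <= B) -> (forall n, 0 <= y n <= B) ->
     (x n - y n) @[n --> \oo] --> (0 : R) -> L x = L y) ->
  let theta X := sup [set L (fun n => n%:R^-1 * angle_sum (restr A X) n v) |
     v in [set v : subvs_of X | v != 0]] in
  theta fullv = Num.max (theta Xs) (theta Xu).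
Proof.
move=> Lle Lasymp theta.
pose l w := L (fun n => n%:R^-1 * asum A n w).
have thetaE X : invariant_subspace A X ->
    theta X = sup [set l w | w in [set w | w \in X /\ w != 0]].
  move=> AX; rewrite -image_subvs_nonzero; congr sup.
  apply: eq_imagel => v _; congr L.
  by apply/funext => n; rewrite angle_sumE.
have avgB w n : 0 <= n%:R^-1 * asum A n w <= pi / 2.
  rewrite mulr_ge0 ?invr_ge0 ?asum_ge0 //=.
  case: n => [|n]; first by rewrite invr0 mul0r divr_ge0 // pi_ge0.
  by rewrite ler_pdivrMl // asum_le.
have ub X w : invariant_subspace A X -> w \in X -> w != 0 -> l w <= theta X.
  move=> AX wX w0; rewrite thetaE //; apply: ub_le_sup; last by exists w.
  by exists (pi / 2) => _ [v _ <-]; apply: Lle.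
have lub X (c : R) : invariant_subspace A X -> X != 0%VS ->
    (forall w, w \in X -> w != 0 -> l w <= c) -> theta X <= c.
  move=> AX X0 H; rewrite thetaE //; apply: ge_sup.
    by have [w wX] := nonzero_vector_ex X0; exists (l w), w.
  by move=> _ [w [wX w0] <-]; apply: H.
apply/eqP; rewrite eq_le ge_max; apply/and3P; split.
- apply: lub => //; first exact: fullv_neq0.
  move=> w _; have [s [u [sX uX ->]]] := decomposition w.
  have [->|u0] := eqVneq u 0.
    by rewrite addr0 le_max => s0; rewrite ub.
  move=> _; rewrite le_max; apply/orP; right.
  have -> : l (s + u) = l u; last exact: ub.
  apply: (Lasymp _ _ (pi / 2)) => //.
  have H : (n%:R^-1 * (asum A n (s + u) - asum A n u)) @[n --> \oo] --> (0 : R).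
    apply: (@avg_cvg R (fun n => asum A n (s + u) - asum A n u)) => e e0.
    have [M HM] := asum_asymp Au As AXu gap sX uX u0 e0.
    by exists M => n; rewrite mulr0 subr0.
  by under eq_fun do rewrite -mulrBr.
- by apply: lub => // w _ w0; rewrite ub ?memvf.
- by apply: lub => // w _ w0; rewrite ub ?memvf.
Qed.

End AngularValues.

Theorem lemma5p5 (R : realType) (d : nat) (A : 'M[R]_d)
    (Xs Xu : {vspace 'cV[R]_d}) :
  A \in unitmx ->
  (Xs + Xu)%VS = fullv -> (Xs :&: Xu)%VS = 0%VS ->
  Xs != 0%VS -> Xu != 0%VS ->
  invariant_subspace A Xs -> invariant_subspace A Xu ->
  (forall lam mu : R[i], spectrum (restr A Xs) lam ->
     spectrum (restr A Xu) mu -> `|lam| < `|mu|) ->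
  [/\ upper_inner (restr A fullv) =
        Num.max (upper_inner (restr A Xs)) (upper_inner (restr A Xu)),
      lower_inner (restr A fullv) =
        Num.max (lower_inner (restr A Xs)) (lower_inner (restr A Xu)),
      upper_outer (restr A fullv) =
        Num.max (upper_outer (restr A Xs)) (upper_outer (restr A Xu)) &
      lower_outer (restr A fullv) =
        Num.max (lower_outer (restr A Xs)) (lower_outer (restr A Xu))].
Proof.
move=> Au Xsu _ Xs0 Xu0 As AXu gap.
have [upi loi] := inner_max Au Xsu Xs0 Xu0 As AXu gap.
split=> //.
- by apply: (outer_max Au Xsu Xs0 Xu0 As AXu gap);
    [exact: limn_sup_le | exact: limn_sup_asymp].
- by apply: (outer_max Au Xsu Xs0 Xu0 As AXu gap);
    [exact: limn_inf_le | exact: limn_inf_asymp].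
Qed.
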